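(* Let $V^*$ be the dual of the vector module of $gl(m|n)$ and $V(\Lambda)$ a finite-dimensional irreducible $gl(m|n)$-module with highest weight $\Lambda$. Assume the numbers $\chi_{\Lambda-\varepsilon_r}(I_2)$, $1\le r\le m+n$, are pairwise distinct (equivalently, the roots $\alpha_r$ are pairwise distinct). Then $V^*\otimes V(\Lambda)$ is completely reducible, with maximal weight vectors of weights of the form $\Lambda-\varepsilon_r$ ($1\le r\le m+n$), each weight occurring at most once.
   Context: $gl(m|n)$ over $\mathbb{C}$ has basis $E_{pq}$ ($1\le p,q\le m+n$) of parity $(p)+(q)$, $(p)=0$ for $p\le m$ and $1$ otherwise, with graded bracket $[E_{pq},E_{rs}]=\delta_{qr}E_{ps}-(-1)^{((p)+(q))((r)+(s))}\delta_{ps}E_{rq}$. The vector module $V$ has basis $|s\rangle$ with $E_{pq}|s\rangle=\delta_{qs}|p\rangle$, and $V^*$ is its dual module. Weights are written $\Lambda=\sum_{i=1}^m\Lambda_i\varepsilon_i+\sum_{\mu=1}^n\Lambda_\mu\delta_\mu$, with $\varepsilon_{m+\mu}:=\delta_\mu$. Bilinear form $(\Lambda,\Lambda')=\sum_i\Lambda_i\Lambda'_i-\sum_\mu\Lambda_\mu\Lambda'_\mu$, $\rho=\frac12\sum_{j=1}^m(m-n-2j+1)\varepsilon_j+\frac12\sum_{\nu=1}^n(m+n-2\nu+1)\delta_\nu$, and $\chi_\mu(I_2)=(\mu,\mu+2\rho)$ (the eigenvalue of the quadratic Casimir $I_2=\sum_{p,q}(-1)^{(q)}E_{pq}E_{qp}$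 on the irreducible module of highest weight $\mu$). The roots are $\alpha_i=\Lambda_i+m-n-i$ ($1\le i\le m$), $\alpha_{m+\mu}=\mu-\Lambda_\mu-n$ ($1\le\mu\le n$). A maximal weight vector is a weight vector annihilated by all $E_{pq}$, $p<q$. *)

(* Defs.v *)
From HB Require Import structures.
From mathcomp Require Import all_boot all_order all_algebra.
From mathcomp Require Import mxtens.
Set Implicit Arguments. Unset Strict Implicit. Unset Printing Implicit Defensive.
Import Order.TTheory GRing.Theory Num.Theory.
Local Open Scope ring_scope.

(* Index set {1,...,m+n} of gl(m|n) is 'I_(m+n) (0-based): p < m even, p >= m odd. *)
Definition par (m n : nat) (p : 'I_(m + n)) : bool := (m <= p)%N.
Definition epar (m n : nat) (p q : 'I_(m + n)) : bool := par p (+) par q.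

(* A (finite-dimensional) gl(m|n)-module of dimension d over C: a grading
   operator J (parity involution, J = +1 on the even part, -1 on the odd part)
   and matrices rho p q : operators of E_pq acting on column vectors 'cV_d,
   homogeneous of parity (p)+(q) and satisfying the graded bracket relations. *)
Definition is_rep (C : numClosedFieldType) (m n d : nat) (J : 'M[C]_d)
  (rho : 'I_(m + n) -> 'I_(m + n) -> 'M[C]_d) : Prop :=
  J *m J = 1%:M /\
  (forall p q, J *m rho p q *m J = (-1) ^+ epar p q *: rho p q) /\
  (forall p q r s,
     rho p q *m rho r s - (-1) ^+ (epar p q && epar r s) *: (rho r s *m rho p q)
     = (q == r)%:R *: rho p s
       - ((-1) ^+ (epar p q && epar r s) * (p == s)%:R) *: rho r q).

(* Subspaces of C^d are row spaces of matrices U (rows = coordinate vectors).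
   A submodule is a graded (J-stable) subspace stable under all E_pq. *)
Definition submod (C : numClosedFieldType) (m n d : nat) (J : 'M[C]_d)
  (rho : 'I_(m + n) -> 'I_(m + n) -> 'M[C]_d) (U : 'M[C]_d) : Prop :=
  (U *m J^T <= U)%MS /\ (forall p q, (U *m (rho p q)^T <= U)%MS).

Definition irreducible (C : numClosedFieldType) (m n d : nat) (J : 'M[C]_d)
  (rho : 'I_(m + n) -> 'I_(m + n) -> 'M[C]_d) : Prop :=
  (0 < d)%N /\
  (forall U : 'M[C]_d, submod J rho U -> \rank U = 0%N \/ \rank U = d).

Definition completely_reducible (C : numClosedFieldType) (m n d : nat)
  (J : 'M[C]_d) (rho : 'I_(m + n) -> 'I_(m + n) -> 'M[C]_d) : Prop :=
  forall U : 'M[C]_d, submod J rho U ->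
    exists W : 'M[C]_d, submod J rho W /\
      \rank (U :&: W)%MS = 0%N /\ row_full (U + W)%MS.

(* weights: functions 'I_(m+n) -> C, mu p = coefficient of eps_p *)
Definition weight_vector (C : numClosedFieldType) (m n d : nat)
  (rho : 'I_(m + n) -> 'I_(m + n) -> 'M[C]_d) (mu : 'I_(m + n) -> C)
  (v : 'cV[C]_d) : Prop :=
  v != 0 /\ (forall p, rho p p *m v = mu p *: v).

Definition maximal_vector (C : numClosedFieldType) (m n d : nat)
  (rho : 'I_(m + n) -> 'I_(m + n) -> 'M[C]_d) (mu : 'I_(m + n) -> C)
  (v : 'cV[C]_d) : Prop :=
  weight_vector rho mu v /\
  (forall p q : 'I_(m + n), (p < q)%N -> rho p q *m v = 0).

(* The dual V^* of the vector module V (E_pq |s> = delta_qs |p>), w.r.t. the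
   dual basis <s| (parity of <s| = parity of s), with the super sign rule
   (x f)(v) = - (-1)^{|x||f|} f(x v). *)
Definition Vdual_J (C : numClosedFieldType) (m n : nat) : 'M[C]_(m + n) :=
  \matrix_(t, s) ((t == s)%:R * (-1) ^+ par s).

Definition Vdual_rho (C : numClosedFieldType) (m n : nat) (p q : 'I_(m + n))
  : 'M[C]_(m + n) :=
  \matrix_(t, s) (- ((-1) ^+ (epar p q && par s)) * ((p == s) && (q == t))%:R).

(* Super tensor product V^* (x) W: x(a (x) b) = xa (x) b + (-1)^{|x||a|} a (x) xb *)
Definition tens_J (C : numClosedFieldType) (m n d : nat) (J : 'M[C]_d)
  : 'M[C]_((m + n) * d) := tensmx (Vdual_J C m n) J.

Definition tens_rho (C : numClosedFieldType) (m n d : nat)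
  (rho : 'I_(m + n) -> 'I_(m + n) -> 'M[C]_d) (p q : 'I_(m + n))
  : 'M[C]_((m + n) * d) :=
  tensmx (Vdual_rho C p q) (1%:M : 'M[C]_d)
  + tensmx (if epar p q then Vdual_J C m n else 1%:M) (rho p q).

Definition eps (C : numClosedFieldType) (m n : nat) (r : 'I_(m + n))
  : 'I_(m + n) -> C := fun p => (p == r)%:R.

Definition bform (C : numClosedFieldType) (m n : nat) (mu nu : 'I_(m + n) -> C)
  : C := \sum_(p < m + n) (-1) ^+ par p * mu p * nu p.

(* rho = 1/2 sum_j (m-n-2j+1) eps_j + 1/2 sum_nu (m+n-2nu+1) delta_nu,
   with j = p+1 for p < m and nu = p-m+1 for p >= m (0-based p). *)
Definition rhovec (C : numClosedFieldType) (m n : nat) (p : 'I_(m + n)) : C :=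
  if (p < m)%N then
    (m%:R - n%:R - 2 * (p.+1)%:R + 1) / 2
  else
    (m%:R + n%:R - 2 * ((p - m).+1)%:R + 1) / 2.

Definition chi (C : numClosedFieldType) (m n : nat) (mu : 'I_(m + n) -> C) : C :=
  bform mu (fun p => mu p + 2 * @rhovec C m n p).

(* Main.v *)
Require Import Defs.
From HB Require Import structures.
From mathcomp Require Import all_boot all_order all_algebra.
From mathcomp Require Import mxtens.
From mathcomp Require Import ring zify.
From Stdlib Require Import Classical.
Set Implicit Arguments. Unset Strict Implicit. Unset Printing Implicit Defensive.
Import Order.TTheory GRing.Theory Num.Theory.
Local Open Scope ring_scope.

(** Let v be a homogeneous highest weight vector of V(Lam) and <s| the dual basis
    of V^*. If r is the least index with a nonzero component in a maximal vector x
    of V^* (x) V(Lam), that component is maximal in V(Lam), hence proportional to v;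
    so x has weight Lam - eps_r and is determined by it up to a scalar.

    Let F_t be the submodule generated by the <s| (x) v with s >= t. Then F_0 is
    everything, and <r| (x) v is maximal modulo F_(r+1), so the Casimir element
    acts on F_r / F_(r+1) by the scalar chi_(Lam - eps_r). If a submodule Y contains
    F_(r+1) but not F_r, applying the product of the (casimir - chi_(Lam - eps_s)),
    s > r, to <r| (x) v gives a maximal vector u outside Y, because the chi's are
    distinct. The module generated by u meets Y trivially: a nonzero intersection
    would contain a maximal vector, which has the same Casimir eigenvalue as u and
    therefore is a multiple of u. Starting with Y = U + W and enlarging W in this
    way produces a complement of U. *)

(** * Subspaces of column vectors given by predicates; eigenvectors *)

Section Subspaces.
Variables (C : numClosedFieldType) (d : nat).
Implicit Types (P : 'cV[C]_d -> Prop) (x y : 'cV[C]_d) (A H : 'M[C]_d).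

Definition subspace P : Prop :=
  [/\ P 0, forall x y, P x -> P y -> P (x + y) & forall c x, P x -> P (c *: x)].

Lemma subspaceB P x y : subspace P -> P x -> P y -> P (x - y).
Proof. by case=> _ PD PZ Px Py; apply: PD => //; rewrite -scaleN1r; apply: PZ. Qed.

Lemma subspace_sum P (I : Type) (s : seq I) (F : I -> 'cV[C]_d) :
  subspace P -> (forall i, P (F i)) -> P (\sum_(i <- s) F i).
Proof. by case=> P0 PD _ PF; apply: big_ind. Qed.

Lemma subspace_rows (U : 'M[C]_d) : subspace (fun x => (x^T <= U)%MS).
Proof.
split=> [|x y xU yU|c x xU]; first by rewrite trmx0 sub0mx.
  by rewrite raddfD addmx_sub.
by rewrite linearZ scalemx_sub.
Qed.

(** While [U] misses a vector of [P], adjoining that vector raises the rank, which [d] bounds. This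
    links predicates, convenient for closure conditions, to the row spaces used in [submod]. *)
Lemma subspace_mx P : subspace P ->
  exists U : 'M[C]_d, forall x, P x <-> (x^T <= U)%MS.
Proof.
case=> P0 PD PZ.
have grow k : exists U : 'M[C]_d, (forall x, (x^T <= U)%MS -> P x) /\
    ((k <= \rank U)%N \/ forall x, P x -> (x^T <= U)%MS).
  elim: k => [|k [U [UP kU]]].
    exists 0; split; last by left.
    by move=> x; rewrite submx0 trmx_eq0 => /eqP->.
  case: kU => [kU|]; last by exists U; split=> //; right.
  have [|] := classic (forall x, P x -> (x^T <= U)%MS).
    by exists U; split=> //; right.
  move=> /not_all_ex_not[x] nx; have [Px /negP xNU] := imply_to_and _ _ nx.
  exists (U + x^T)%MS; split=> [y /sub_addsmxP[[u1 u2] /= Dy]|].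
    rewrite -[y]trmxK Dy raddfD /= [u2]mx11_scalar mul_scalar_mx linearZ /= trmxK.
    apply: PD; last exact: PZ.
    by apply: UP; rewrite trmxK submxMl.
  left; apply: leq_ltn_trans kU _; apply: rank_ltmx.
  rewrite /ltmx addsmxSl /=; apply: contra xNU; apply: submx_trans.
  exact: addsmxSr.
have [U [UP [|PU]]] := grow d.+1; first by rewrite ltnNge rank_leq_row.
by exists U => x; split; [apply: PU | apply: UP].
Qed.

Lemma rows_subP (U W : 'M[C]_d) :
  (forall x, (x^T <= U)%MS -> (x^T <= W)%MS) -> (U <= W)%MS.
Proof.
by move=> UW; apply/row_subP=> i; rewrite -[row i U]trmxK UW ?trmxK ?row_sub.
Qed.

(** The product of the [H - a] over the eigenvalues [a != b] in [s] kills the other terms and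
    multiplies those of eigenvalue [b] by a nonzero scalar. Eigenvalues may repeat in [s], so the
    conclusion concerns the sum over one eigenvalue, not single vectors. *)
Lemma eigenvectors_indep H (s : seq (C * 'cV[C]_d)) (b : C) :
  (forall z, z \in s -> H *m z.2 = z.1 *: z.2) -> \sum_(z <- s) z.2 = 0 ->
  \sum_(z <- s | z.1 == b) z.2 = 0.
Proof.
move=> eigH sum0.
pose T l := foldr (fun a M => M *m (H - a%:M)) (1%:M : 'M[C]_d) l.
have T_eig l (a : C) x : H *m x = a *: x -> T l *m x = \prod_(c <- l) (a - c) *: x.
  move=> Hx; elim: l => [|c l IH] /=; first by rewrite big_nil mul1mx scale1r.
  rewrite -mulmxA mulmxBl Hx mul_scalar_mx -scalerBl -scalemxAr IH scalerA.
  by rewrite big_cons.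
pose l := [seq z.1 | z <- s & z.1 != b].
have c_neq0 : \prod_(c <- l) (b - c) != 0.
  rewrite prodf_seq_neq0; apply/allP => c /mapP[z]; rewrite mem_filter => /andP[zb _ ->].
  by rewrite /= subr_eq0 eq_sym.
apply: (scalerI c_neq0); rewrite scaler0 scaler_sumr.
transitivity (T l *m \sum_(z <- s) z.2); last by rewrite sum0 mulmx0.
rewrite mulmx_sumr big_mkcond /=; apply: eq_big_seq => z zs; rewrite (T_eig _ z.1) ?eigH //.
case: eqVneq => [->//|zb].
suff -> : \prod_(c <- l) (z.1 - c) = 0 by rewrite scale0r.
apply/eqP; rewrite prodf_seq_eq0; apply/hasP; exists z.1; last by rewrite subrr /=.
by apply/mapP; exists z; rewrite // mem_filter zb.
Qed.

(** In a row basis of the subspace, the restriction of [A] becomes a square matrix [M] of positive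
    size, which has an eigenvector because [C] is algebraically closed. *)
Lemma stable_eigenvector A P x : subspace P -> (forall y, P y -> P (A *m y)) ->
  P x -> x != 0 -> exists y a, [/\ P y, y != 0 & A *m y = a *: y].
Proof.
move=> sP AP Px x0; have [U PU] := subspace_mx sP.
have Ugt0 : (0 < \rank U)%N.
  rewrite lt0n mxrank_eq0; apply: contra x0 => /eqP U0.
  by move/PU: Px; rewrite U0 submx0 trmx_eq0.
have /submxP[M DM] : (row_base U *m A^T <= row_base U)%MS.
  rewrite stablemx_row_base; apply/row_subP => i.
  rewrite row_mul -[row i U]trmxK -trmx_mul.
  by apply/PU/AP/PU; rewrite trmxK row_sub.
have [a /eigenvalueP[v vM v0]] := eigenvalue_closed M Ugt0.
exists (v *m row_base U)^T, a; split.
- by apply/PU; rewrite trmxK -(eq_row_base U) submxMl.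
- rewrite trmx_eq0; apply: contra v0 => /eqP vU.
  by apply/eqP/(row_free_inj (row_base_free U)); rewrite vU mul0mx.
- by rewrite -[A]trmxK -trmx_mul -mulmxA DM mulmxA vM -scalemxAl linearZ.
Qed.

End Subspaces.

(** * Weights, the height grading and the existence of maximal vectors *)

Section Representations.
Variables (C : numClosedFieldType) (m n d : nat).
Variable rho : 'I_(m + n) -> 'I_(m + n) -> 'M[C]_d.
Implicit Types (P Y : 'cV[C]_d -> Prop) (x y v w : 'cV[C]_d) (p q r : 'I_(m + n)).
Implicit Types (mu : 'I_(m + n) -> C).

(** The bracket clause of [is_rep], separated so that it can be checked on its own for $V^*$ and for
    the tensor product. *)
Definition graded_bracket : Prop := forall p q r s,
  rho p q *m rho r s - (-1) ^+ (epar p q && epar r s) *: (rho r s *m rho p q)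
  = (q == r)%:R *: rho p s
    - ((-1) ^+ (epar p q && epar r s) * (p == s)%:R) *: rho r q.

Definition stable P : Prop := forall p q x, P x -> P (rho p q *m x).

(* E_pq has degree q - p for this grading element. *)
Definition height : 'M[C]_d := \sum_(p < m + n) (- (p : nat)%:R) *: rho p p.

Definition height_of mu : C := \sum_(p < m + n) (- (p : nat)%:R) * mu p.

Definition casimir : 'M[C]_d :=
  \sum_p \sum_q (-1) ^+ par q *: (rho p q *m rho q p).

Hypothesis brk : graded_bracket.

Lemma bracketE p q r s :
  rho p q *m rho r s = (-1) ^+ (epar p q && epar r s) *: (rho r s *m rho p q)
   + ((q == r)%:R *: rho p s
     - ((-1) ^+ (epar p q && epar r s) * (p == s)%:R) *: rho r q).
Proof. by rewrite -brk [RHS]addrC subrK. Qed.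

Lemma eparpp p : epar p p = false.
Proof. by rewrite /epar addbb. Qed.

Lemma cartan_bracket p r s :
  rho p p *m rho r s = rho r s *m rho p p
   + ((p == r)%:R - (p == s)%:R) *: rho r s.
Proof.
rewrite bracketE eparpp /= scale1r mul1r scalerBl; congr (_ + (_ - _)).
  by case: eqP => [->|]; rewrite ?scale0r.
by case: eqP => [->|]; rewrite ?scale0r.
Qed.

Lemma weight_act mu x r s : (forall p, rho p p *m x = mu p *: x) ->
  forall p, rho p p *m (rho r s *m x) =
    (mu p + (p == r)%:R - (p == s)%:R) *: (rho r s *m x).
Proof.
move=> xmu p; rewrite mulmxA cartan_bracket mulmxDl -mulmxA xmu -scalemxAr.
by rewrite -scalemxAl -scalerDl addrA.
Qed.

Lemma height_weight mu x : (forall p, rho p p *m x = mu p *: x) ->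
  height *m x = height_of mu *: x.
Proof.
move=> xmu; rewrite mulmx_suml scaler_suml; apply: eq_bigr => p _.
by rewrite -scalemxAl xmu scalerA.
Qed.

Lemma height_act a x r s : height *m x = a *: x ->
  height *m (rho r s *m x) = (a + s%:R - r%:R) *: (rho r s *m x).
Proof.
move=> xa; rewrite mulmxA.
have -> : height *m rho r s = rho r s *m height + (s%:R - r%:R) *: rho r s.
  rewrite mulmx_suml mulmx_sumr.
  rewrite (eq_bigr (fun p => rho r s *m ((- (p : nat)%:R) *: rho p p) +
     (- (p : nat)%:R * ((p == r)%:R - (p == s)%:R)) *: rho r s)); last first.
    by move=> p _; rewrite -scalemxAl cartan_bracket scalerDr scalerA scalemxAr.
  rewrite big_split /=; congr (_ + _); rewrite -scaler_suml; congr (_ *: _).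
  rewrite (eq_bigr (fun p : 'I_(m + n) =>
     (if p == s then p%:R else 0) - (if p == r then p%:R else 0))); last first.
    by move=> p _; do 2 case: eqP => _; rewrite /= ?mulr1n ?mulr0n; ring.
  by rewrite sumrB -!big_mkcond /= !big_pred1_eq.
by rewrite mulmxDl -mulmxA xa -scalemxAr -scalemxAl -scalerDl addrA.
Qed.

(** The $E_{pp}$ commute, so the common eigenspace inside [Y] of those already treated is stable
    under the next one, which therefore has an eigenvector in it. *)
Lemma weight_vector_exists Y x : subspace Y -> stable Y -> Y x -> x != 0 ->
  exists mu y, Y y /\ weight_vector rho mu y.
Proof.
move=> sY stY Yx x0.
have step (l : seq 'I_(m + n)) : exists mu y,
    [/\ Y y, y != 0 & forall p, p \in l -> rho p p *m y = mu p *: y].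
  elim: l => [|p l [mu [y [Yy y0 ymu]]]]; first by exists (fun=> 0), x.
  pose P z := Y z /\ (forall q, q \in l -> rho q q *m z = mu q *: z).
  have sP : subspace P.
    case: sY => Y0 YD YZ; split.
    - by split=> // q _; rewrite mulmx0 scaler0.
    - move=> z z' [Yz zl] [Yz' zl']; split; first exact: YD.
      by move=> q ql; rewrite mulmxDr zl // zl' // scalerDr.
    - move=> c z [Yz zl]; split; first exact: YZ.
      by move=> q ql; rewrite -scalemxAr zl // !scalerA mulrC.
  have [||z [a [[Yz zl] z0 za]]] := @stable_eigenvector _ _ (rho p p) P y sP _ _ y0.
  - move=> z [Yz zl]; split; first exact: stY.
    move=> q ql; rewrite mulmxA cartan_bracket subrr scale0r addr0.
    by rewrite -mulmxA zl // -scalemxAr.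
  - by [].
  exists (fun q => if q == p then a else mu q), z; split=> // q.
  by rewrite inE; case: eqVneq => [->|] //= _ /zl.
have [mu [y [Yy y0 ymu]]] := step (enum 'I_(m + n)).
by exists mu, y; do 2 split=> //; move=> p; rewrite ymu ?mem_enum.
Qed.

(** The roots of the characteristic polynomial. The list limits how often raising operators can be
    applied in [maximal_vector_exists]. *)
Lemma height_eigenvalues : exists l : seq C,
  forall x a, x != 0 -> height *m x = a *: x -> a \in l.
Proof.
have [l Dl] := closed_field_poly_normal (char_poly height^T).
exists l => x a x0 xa.
have : root (char_poly height^T) a.
  rewrite -eigenvalue_root_char; apply/eigenvalueP; exists x^T; last by rewrite trmx_eq0.
  by rewrite -trmx_mul xa linearZ.
by rewrite Dl (monicP (char_poly_monic _)) scale1r root_prod_XsubC.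
Qed.

Lemma maximal_vector_exists Y x : subspace Y -> stable Y -> Y x -> x != 0 ->
  exists mu y, Y y /\ maximal_vector rho mu y.
Proof.
move=> sY stY Yx x0; have [l lP] := height_eigenvalues.
have [mu [y [Yy ymu]]] := weight_vector_exists sY stY Yx x0.
(* Raising operators increase the height, which takes finitely many values. *)
have [k] := ubnP (count (fun a => height_of mu < a) l).
elim: k => // k IH in mu y Yy ymu *; rewrite ltnS => le_k.
have [ymax|] := classic (forall p q, (p < q)%N -> rho p q *m y = 0).
  by exists mu, y.
move=> /not_all_ex_not[p] /not_all_ex_not[q] nmax.
have [lt_pq /eqP z0] := imply_to_and _ _ nmax.
pose nu r := mu r + (r == p)%:R - (r == q)%:R.
have znu : weight_vector rho nu (rho p q *m y).
  by split=> // r; apply: weight_act; case: ymu.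
have lt_h : height_of mu < height_of nu.
  have [y0 wy] := ymu; have [_ wz] := znu.
  have := height_act p q (height_weight wy); rewrite (height_weight wz) => /eqP.
  rewrite -subr_eq0 -scalerBl scaler_eq0 (negPf z0) orbF subr_eq0 => /eqP->.
  by rewrite -addrA ltrDl subr_gt0 ltr_nat.
apply: (IH nu (rho p q *m y)) => //; first exact: stY.
(* The count drops strictly: [height_of nu] is a listed eigenvalue above [height_of mu] but not
   above itself. *)
apply: leq_trans le_k; rewrite -[leqRHS]size_filter.
rewrite -(count_predC (fun a => height_of nu < a)) -addn1 leq_add //.
  rewrite count_filter sub_count // => a /= nua; rewrite nua.
  exact: lt_trans lt_h nua.
rewrite -has_count; apply/hasP; exists (height_of nu) => /=; last by rewrite ltxx.
by rewrite mem_filter lt_h (lP _ _ z0) //; apply: height_weight; case: znu.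
Qed.

(** * The quadratic Casimir element: its eigenvalue and its centrality *)

Lemma sum_gt_ord k a : \sum_(i < k) (a < i)%:R = (k - a.+1)%:R :> C.
Proof.
elim: k => [|k IH]; first by rewrite big_ord0.
rewrite big_ord_recr /= IH -natrD; congr _%:R.
by case: (ltnP a k) => h; lia.
Qed.

Lemma sum_lt_ord k a : \sum_(i < k) (i < a)%:R = (minn k a)%:R :> C.
Proof.
elim: k => [|k IH]; first by rewrite big_ord0 min0n.
rewrite big_ord_recr /= IH -natrD; congr _%:R.
by case: (ltnP k a) => h; lia.
Qed.

(** With positive roots $\varepsilon_p-\varepsilon_q$, $p<q$, the weight $2\rho$ is the sum of the
    even ones minus the sum of the odd ones. This is its coefficient at [p], up to the sign
    $(-1)^{(p)}$. *)
Lemma sum_sign_rhovec (p : 'I_(m + n)) :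
  \sum_(q < m + n) (-1) ^+ par q * ((p < q)%:R - (q < p)%:R) = (-1) ^+ par p * (2 * rhovec C p).
Proof.
rewrite big_split_ord /=.
under eq_bigr => i _ do rewrite /par /= leqNgt ltn_ord expr0 mul1r.
rewrite sumrB sum_gt_ord sum_lt_ord.
under eq_bigr => i _ do rewrite /par /= leq_addr expr1 mulN1r opprB.
rewrite sumrB.
under eq_bigr => i _ do rewrite -ltn_subRL.
rewrite sum_lt_ord.
have p_lt := ltn_ord p; rewrite /rhovec /par [(m <= p)%N]leqNgt.
have [h|h] := boolP (p < m)%N; rewrite /= ?expr0 ?expr1.
  under eq_bigr => i _ do rewrite (leq_trans h (leq_addr _ _)).
  rewrite sumr_const card_ord.
  rewrite natrB // (_ : minn m p = p); last by lia.
  have -> : (p - m = 0)%N by lia. rewrite minn0 -[(p.+1)%:R]natr1 -[true%:R *+ n]/(n%:R).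
  by move: (m%:R : C) (n%:R : C) (p%:R : C) => M N K; field.
have E (i : 'I_n) : (p < m + i)%N = (p - m < i)%N.
  by apply/idP/idP; lia.
under eq_bigr => i _ do rewrite E.
rewrite sum_gt_ord.
have -> : (m - p.+1 = 0)%N by lia.
have -> : minn m p = m by lia.
have -> : minn n (p - m) = (p - m)%N by lia.
rewrite [(n - _)%:R]natrB; last by lia.
rewrite -[((p - m).+1)%:R]natr1.
by move: (m%:R : C) (n%:R : C) ((p - m)%:R : C) => M N K; field.
Qed.

(** In each product $E_{pq}E_{qp}$ with $p\ne q$ the raising factor is brought to the right, where
    it sends [x] into [Y]; the bracket leaves only Cartan terms. [Y = 0] gives the eigenvalue on
    maximal vectors, and later [Y] is the next step of a filtration. *)
Lemma casimir_eigen_mod Y mu x : subspace Y -> stable Y ->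
  (forall p, rho p p *m x = mu p *: x) ->
  (forall p q, (p < q)%N -> Y (rho p q *m x)) ->
  Y (casimir *m x - chi mu *: x).
Proof.
move=> sY stY xmu Yx.
(* [c p q] is the scalar by which the term indexed by [p], [q] acts on [x] modulo [Y]. It is zero
   for [q < p], where the raising factor already stands on the right. *)
pose c p q : C := (p == q)%:R * ((-1) ^+ par p * mu p ^+ 2)
  + (p < q)%:R * ((-1) ^+ par q * mu p - (-1) ^+ par p * mu q).
have Yc p q : Y ((-1) ^+ par q *: (rho p q *m (rho q p *m x)) - c p q *: x).
  have [Y0 YD YZ] := sY; rewrite /c -val_eqE /=; case: ltngtP => [lt_pq|lt_qp|/val_inj->].
  - rewrite mul0r add0r mul1r mulmxA bracketE eqxx !mulmxDl.
    rewrite mulNmx -!scalemxAl !xmu -mulmxA [(-1)^+_ *: (_ + _)]scalerDr.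
    rewrite -addrA; set z := _ - _ *: x.
    suff -> : z = 0 by rewrite addr0; do 2! apply: (YZ _ _); apply/stY/Yx.
    rewrite /z eqxx !(scale1r, mulr1) scalerBr !scalerA -scalerBl -scalerBl.
    apply/eqP; rewrite scaler_eq0 /epar; apply/orP; left.
    by case: (par p); case: (par q); rewrite /= ?expr0 ?expr1; apply/eqP; ring.
  - by rewrite !mul0r addr0 scale0r subr0; apply/YZ/stY/Yx.
  rewrite mul0r mul1r addr0 !(xmu, =^~ scalemxAr) !scalerA.
  by rewrite expr2 mulrA subrr.
have -> : chi mu = \sum_p \sum_q c p q.
  rewrite /chi /bform.
  have -> : \sum_p \sum_q c p q = \sum_(p < m + n) (-1) ^+ par p * mu p ^+ 2
      + \sum_(p < m + n) mu p * (\sum_(q < m + n) (-1) ^+ par q * ((p < q)%:R - (q < p)%:R)).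
    under eq_bigr => p _ do rewrite big_split /=.
    rewrite big_split /=; congr (_ + _).
      apply: eq_bigr => p _; rewrite (bigD1 p) //= eqxx mul1r big1 ?addr0 // => q.
      by rewrite eq_sym => /negPf->; rewrite mul0r.
    under eq_bigr => p _ do (under eq_bigr => q _ do rewrite mulrBr; rewrite sumrB).
    rewrite sumrB [X in _ - X]exchange_big -sumrB /=; apply: eq_bigr => p _.
    by rewrite mulr_sumr -sumrB; apply: eq_bigr => q _; ring.
  by rewrite -big_split; apply: eq_bigr => p _; rewrite sum_sign_rhovec /=; ring.
rewrite mulmx_suml scaler_suml -sumrB; apply: subspace_sum => // p.
rewrite mulmx_suml scaler_suml -sumrB; apply: subspace_sum => // q.
by rewrite -scalemxAl -mulmxA.
Qed.

Lemma casimir_maximal mu x : maximal_vector rho mu x ->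
  casimir *m x = chi mu *: x.
Proof.
move=> [[_ xmu] xmax]; apply/eqP; rewrite -subr_eq0.
apply/eqP; apply: (@casimir_eigen_mod (fun y => y = 0)) => //.
  by split=> // [? ? -> ->|c ? ->]; rewrite ?addr0 ?scaler0.
by move=> ? ? ? ->; rewrite mulmx0.
Qed.

(** The Casimir element is even, so centrality is an ordinary commutation relation without signs. *)
Lemma casimir_comm a b : rho a b *m casimir = casimir *m rho a b.
Proof.
(* The graded Leibniz rule. $E_{pq}$ and $E_{qp}$ have the same parity, so the two signs from
   passing both of them multiply to 1. *)
have term p q : rho a b *m (rho p q *m rho q p) - rho p q *m rho q p *m rho a b
  = (b == p)%:R *: (rho a q *m rho q p)
    - ((-1) ^+ (epar a b && epar p q) * (a == q)%:R) *: (rho p b *m rho q p)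
    + (-1) ^+ (epar a b && epar p q) *: (rho p q *m
    ((b == q)%:R *: rho a p - ((-1) ^+ (epar a b && epar q p) * (a == p)%:R) *: rho q b)).
  rewrite mulmxA bracketE mulmxDl -scalemxAl -mulmxA bracketE mulmxDr -scalemxAr.
  rewrite scalerDr scalerA (_ : epar q p = epar p q) ?signrMK; last by rewrite /epar addbC.
  rewrite -expr2 sqrr_sign scale1r mulmxA mulmxBl -!scalemxAl.
  by rewrite -[X in X - _]addrA [X in X - _]addrC addrK addrC.
apply/eqP; rewrite -subr_eq0 mulmx_sumr mulmx_suml -sumrB.
under eq_bigr => p _.
  rewrite mulmx_sumr mulmx_suml -sumrB.
  under eq_bigr => q _ do rewrite -scalemxAr -scalemxAl -scalerBr term.
  over.
rewrite /=.
pose F1 p q := ((-1) ^+ par q * (b == p)%:R) *: (rho a q *m rho q p).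
pose F2 p q := (((-1) ^+ par q * (-1) ^+ (epar a b && epar p q)) * (a == q)%:R)
   *: (rho p b *m rho q p).
pose F3 p q := (((-1) ^+ par q * (-1) ^+ (epar a b && epar p q)) * (b == q)%:R)
   *: (rho p q *m rho a p).
pose F4 p q := ((-1) ^+ par q * (a == p)%:R) *: (rho p q *m rho q b).
rewrite (eq_bigr (fun p => \sum_q (F1 p q - F2 p q + (F3 p q - F4 p q)))); last first.
  move=> p _; apply: eq_bigr => q _.
  rewrite (_ : epar q p = epar p q); last by rewrite /epar addbC.
  rewrite mulmxBr -!scalemxAr !(scalerBr, scalerDr) !scalerA !mulrA.
  by congr (_ - _ + (_ - _ *: _)); rewrite -(mulrA ((-1) ^+ par q)) -expr2 sqrr_sign mulr1.
(* Once the Kronecker deltas are summed out, [F1] and [F4] give the same sum, and [F3] and [F2]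
   agree for each [p]. *)
have -> : \sum_p \sum_q (F1 p q - F2 p q + (F3 p q - F4 p q)) =
   (\sum_p \sum_q F1 p q - \sum_p \sum_q F4 p q)
   + (\sum_p \sum_q F3 p q - \sum_p \sum_q F2 p q).
  rewrite -!sumrB -big_split; apply: eq_bigr => p _.
  rewrite -!sumrB -big_split; apply: eq_bigr => q _ /=.
  by rewrite [F3 p q - _]addrC addrACA [- F2 p q + _]addrC.
have E1 : \sum_p \sum_q F1 p q = \sum_(q < m + n) (-1) ^+ par q *: (rho a q *m rho q b).
  rewrite (bigD1 b) //= [X in _ + X]big1 ?addr0 => [|p].
    by apply: eq_bigr => q _; rewrite /F1 eqxx mulr1.
  by rewrite eq_sym => /negPf bp; rewrite big1 // => q _; rewrite /F1 bp mulr0 scale0r.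
have E4 : \sum_p \sum_q F4 p q = \sum_(q < m + n) (-1) ^+ par q *: (rho a q *m rho q b).
  rewrite (bigD1 a) //= [X in _ + X]big1 ?addr0 => [|p].
    by apply: eq_bigr => q _; rewrite /F4 eqxx mulr1.
  by rewrite eq_sym => /negPf bp; rewrite big1 // => q _; rewrite /F4 bp mulr0 scale0r.
rewrite E1 E4 subrr add0r -sumrB big1 // => p _.
rewrite (bigD1 b) //= [X in _ + X - _]big1 => [|q]; last first.
  by rewrite eq_sym /F3 => /negPf->; rewrite mulr0 scale0r.
rewrite [X in _ - X](bigD1 a) //= [X in _ - (_ + X)]big1 => [|q]; last first.
  by rewrite eq_sym /F2 => /negPf->; rewrite mulr0 scale0r.
rewrite !addr0 /F2 /F3 !eqxx !mulr1 -scalerBl /epar.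
apply/eqP; rewrite scaler_eq0; apply/orP; left.
by case: (par a); case: (par b); case: (par p); rewrite /= ?expr0 ?expr1; apply/eqP; ring.
Qed.

(** * Submodules given by generators, and spaces spanned by lowering operators *)

Inductive generated (G : 'cV[C]_d -> Prop) : 'cV[C]_d -> Prop :=
| generated_in x : G x -> generated G x
| generated0 : generated G 0
| generatedD x y : generated G x -> generated G y -> generated G (x + y)
| generatedZ c x : generated G x -> generated G (c *: x)
| generated_act p q x : generated G x -> generated G (rho p q *m x).

Lemma generated_subspace G : subspace (generated G).
Proof. by split; [apply: generated0 | apply: generatedD | apply: generatedZ]. Qed.

Lemma generated_stable G : stable (generated G).
Proof. by move=> p q x; apply: generated_act. Qed.

Lemma generated_min G P : subspace P -> stable P -> (forall x, G x -> P x) ->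
  forall x, generated G x -> P x.
Proof.
move=> [P0 PD PZ] stP GP x; elim=> //; first by move=> ? ? _ ? _ ?; apply: PD.
- by move=> ? ? _; apply: PZ.
- by move=> ? ? ? _; apply: stP.
Qed.

(** This is $U(\mathfrak n^-)v$, where $\mathfrak n^-$ is spanned by the lowering operators. *)
Inductive lowered v : 'cV[C]_d -> Prop :=
| lowered_top : lowered v v
| lowered0 : lowered v 0
| loweredD x y : lowered v x -> lowered v y -> lowered v (x + y)
| loweredZ c x : lowered v x -> lowered v (c *: x)
| lowered_act p q x : (q < p)%N -> lowered v x -> lowered v (rho p q *m x).

(** Moving $E_{pq}$ past a lowering operator $E_{rs}$ leaves multiples of $E_{ps}x$ and $E_{rq}x$
    with the same shorter [x]. Induction for all [p], [q] at once thus replaces a PBW argument. *)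
Lemma lowered_stable mu v : maximal_vector rho mu v -> stable (lowered v).
Proof.
move=> [[_ vmu] vmax] p q x lx.
elim: lx p q => {x} [||x y _ IHx _ IHy|c x _ IHx|r s x lt_sr lx IHx] p q.
- case: (ltngtP p q) => [/vmax->|lt_qp|/val_inj->]; first exact: lowered0.
    by apply: lowered_act => //; apply: lowered_top.
  by rewrite vmu; apply/loweredZ/lowered_top.
- by rewrite mulmx0; apply: lowered0.
- by rewrite mulmxDr; apply: loweredD.
- by rewrite -scalemxAr; apply: loweredZ.
rewrite mulmxA bracketE !mulmxDl mulNmx -!scalemxAl -mulmxA -scaleNr.
apply: loweredD; first by apply: loweredZ; apply: lowered_act.
by apply: loweredD; apply: loweredZ.
Qed.

Lemma lowered_decomposition mu v x : maximal_vector rho mu v -> lowered v x ->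
  exists c s, x = c *: v + \sum_(z <- s) z.2 /\
    forall z, z \in s -> height *m z.2 = z.1 *: z.2 /\
      exists k, z.1 = height_of mu - k.+1%:R.
Proof.
move=> [[_ vmu] _]; have hv := height_weight vmu.
elim=> {x} [||x y _ [c [s [-> sP]]] _ [c' [s' [-> sP']]]
  |a x _ [c [s [-> sP]]]|p q x lt_qp _ [c [s [-> sP]]]].
- by exists 1, [::]; rewrite big_nil scale1r addr0.
- by exists 0, [::]; rewrite big_nil scale0r addr0.
- exists (c + c'), (s ++ s'); split; first by rewrite big_cat scalerDl addrACA.
  by move=> z; rewrite mem_cat => /orP[/sP|/sP'].
- exists (a * c), [seq (z.1, a *: z.2) | z <- s]; split.
    by rewrite big_map scalerDr scalerA scaler_sumr.
  move=> _ /mapP[z zs ->]; have [hz kz] := sP _ zs; split=> //=.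
  by rewrite -scalemxAr hz !scalerA mulrC.
have lt0 : (q%:R - p%:R = - ((p - q).-1.+1)%:R :> C).
  by rewrite prednK ?subn_gt0 // natrB ?opprB // ltnW.
(* The image has no top part: the image of [c *: v] has dropped in height by [p - q] and joins the
   list. *)
exists 0, ((height_of mu + q%:R - p%:R, c *: (rho p q *m v))
  :: [seq (z.1 + q%:R - p%:R, rho p q *m z.2) | z <- s]); split.
  by rewrite big_cons big_map scale0r add0r mulmxDr -scalemxAr mulmx_sumr.
move=> z; rewrite inE => /predU1P[->|/mapP[{}z zs ->]] /=.
  split; first by rewrite -scalemxAr (height_act _ _ hv) !scalerA mulrC.
  by exists (p - q).-1; rewrite -addrA lt0.
have [hz [k zk]] := sP _ zs; split; first exact: height_act.
exists (k + (p - q))%N; rewrite zk -addSn natrD opprD natrB ?(ltnW lt_qp) //.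
by rewrite opprB !addrA.
Qed.

(** Subtracting from [w] its decomposition gives a vanishing sum of [height] eigenvectors, of which
    only the part of eigenvalue [b] is kept. If [b] is the height of [v], that part is [w - c *: v];
    otherwise [b] is one of the strictly lower heights. *)
Lemma lowered_eigenvector mu v w b : maximal_vector rho mu v -> lowered v w ->
  w != 0 -> height *m w = b *: w ->
  exists2 k : nat, b = height_of mu - k%:R & k = 0%N -> exists c, w = c *: v.
Proof.
move=> vmax lw w0 hw; have hv := height_weight vmax.1.2.
have [c [s [Dw sP]]] := lowered_decomposition vmax lw.
pose S := [:: (b, w), (height_of mu, - (c *: v)) & [seq (z.1, - z.2) | z <- s]].
have S_eig z : z \in S -> height *m z.2 = z.1 *: z.2.
  rewrite !inE => /or3P[/eqP->|/eqP->|/mapP[{}z zs ->]] //=.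
    by rewrite mulmxN -scalemxAr hv !scalerN !scalerA mulrC.
  by rewrite mulmxN scalerN (sP _ zs).1.
have S_sum : \sum_(z <- S) z.2 = 0.
  by rewrite !big_cons big_map /= sumrN -opprD -Dw subrr.
have := eigenvectors_indep b S_eig S_sum.
rewrite !big_cons big_map /= eqxx sumrN; case: eqVneq => [Db|_].
  rewrite big_seq_cond big1 => [|z /andP[/sP[_ [k ->]]]].
    rewrite subr0 => /eqP; rewrite subr_eq0 => /eqP ->; exists 0%N; last by exists c.
    by rewrite subr0.
  by rewrite Db -subr_eq0 addrAC subrr add0r oppr_eq0 pnatr_eq0.
move=> /eqP; rewrite subr_eq0 => /eqP Dw'.
have : has (fun z => z.1 == b) s.
  apply: contraNT w0 => /hasPn nb; rewrite Dw' big_seq_cond big1 // => z /andP[/nb/negPf->].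
  by [].
by case/hasP=> z /sP[_ [k zk]] /eqP <-; exists k.+1.
Qed.

(** * Parity, irreducibility and uniqueness of the maximal vector *)

Variable J : 'M[C]_d.
Hypotheses (JJ : J *m J = 1%:M)
  (Jrho : forall p q, J *m rho p q *m J = (-1) ^+ epar p q *: rho p q).

Lemma J_act p q x : J *m (rho p q *m x) = (-1) ^+ epar p q *: (rho p q *m (J *m x)).
Proof. by rewrite scalemxAl -Jrho -!mulmxA (mulmxA J J x) JJ mul1mx. Qed.

Lemma J_maximal mu x : maximal_vector rho mu x -> maximal_vector rho mu (J *m x).
Proof.
have actJ p q y : rho p q *m (J *m y) = (-1) ^+ epar p q *: (J *m (rho p q *m y)).
  by rewrite J_act scalerA -expr2 sqrr_sign scale1r.
move=> [[x0 xmu] xmax]; split; first split.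
- apply: contra x0 => /eqP Jx0.
  by rewrite -[x]mul1mx -JJ -mulmxA Jx0 mulmx0.
- by move=> p; rewrite actJ eparpp scale1r xmu -scalemxAr.
- by move=> p q lt_pq; rewrite actJ xmax // mulmx0 scaler0.
Qed.

Lemma maximal_lin mu c x y : maximal_vector rho mu x -> maximal_vector rho mu y ->
  c *: x + y != 0 -> maximal_vector rho mu (c *: x + y).
Proof.
move=> [[_ xmu] xmax] [[_ ymu] ymax] z0; split; first split=> //.
  by move=> p; rewrite mulmxDr -scalemxAr xmu ymu scalerDr !scalerA mulrC.
by move=> p q lt_pq; rewrite mulmxDr -scalemxAr xmax // ymax // scaler0 addr0.
Qed.

(** [generated] closes under the action only. Since [J] commutes with each operator up to sign,
    being graded is a condition on the generators. *)
Lemma generated_J G : (forall x, G x -> generated G (J *m x)) ->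
  forall x, generated G x -> generated G (J *m x).
Proof.
move=> GJ x; elim=> {x} [//||x y _ Jx _ Jy|c x _ Jx|p q x _ Jx].
- by rewrite mulmx0; apply: generated0.
- by rewrite mulmxDr; apply: generatedD.
- by rewrite -scalemxAr; apply: generatedZ.
- by rewrite J_act; apply/generatedZ/generated_act.
Qed.

Lemma submod_subspace (U : 'M[C]_d) : submod J rho U ->
  stable (fun x => (x^T <= U)%MS) /\ (forall x, (x^T <= U)%MS -> ((J *m x)^T <= U)%MS).
Proof.
move=> [UJ Urho]; split=> [p q x|x] xU; rewrite trmx_mul.
  exact: submx_trans (submxMr _ xU) (Urho p q).
exact: submx_trans (submxMr _ xU) UJ.
Qed.

Lemma submod_pred P : subspace P -> stable P -> (forall x, P x -> P (J *m x)) ->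
  exists2 U : 'M[C]_d, submod J rho U & forall x, P x <-> (x^T <= U)%MS.
Proof.
move=> sP stP JP; have [U PU] := subspace_mx sP; exists U => //.
have stU A : (forall x, P x -> P (A *m x)) -> (U *m A^T <= U)%MS.
  move=> AP; apply/row_subP=> i; rewrite row_mul -[row i U]trmxK -trmx_mul.
  by apply/PU/AP/PU; rewrite trmxK row_sub.
by split=> [|p q]; apply: stU => // x; apply: stP.
Qed.

Hypothesis irr : irreducible J rho.

Lemma irreducible_full P x : subspace P -> stable P ->
  (forall y, P y -> P (J *m y)) -> P x -> x != 0 -> forall y, P y.
Proof.
move=> sP stP JP Px x0 y; have [U sU PU] := submod_pred sP stP JP.
have [/eqP|rU] := irr.2 U sU.
  rewrite mxrank_eq0 => /eqP U0; move/PU: Px.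
  by rewrite U0 submx0 trmx_eq0 (negPf x0).
by apply/PU/submx_full; rewrite -col_leq_rank rU.
Qed.

(** Homogeneity of [v] makes [lowered v] stable under [J], so it is a nonzero graded submodule and
    irreducibility applies. *)
Lemma homogeneous_lowered mu v e : maximal_vector rho mu v -> J *m v = e *: v ->
  forall x, lowered v x.
Proof.
move=> vmax Jv; apply: (@irreducible_full _ v).
- by split; [apply: lowered0 | apply: loweredD | apply: loweredZ].
- exact: lowered_stable vmax.
- move=> x; elim=> {x} [||x y _ Jx _ Jy|c x _ Jx|p q x lt_qp _ Jx].
  + by rewrite Jv; apply/loweredZ/lowered_top.
  + by rewrite mulmx0; apply: lowered0.
  + by rewrite mulmxDr; apply: loweredD.
  + by rewrite -scalemxAr; apply: loweredZ.
  + by rewrite J_act; apply/loweredZ/lowered_act.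
- exact: lowered_top.
by case: vmax => -[].
Qed.

(** For [e] equal to 1 or -1 the vector is twice the even or odd part of [x]. *)
Lemma homogeneous_part x (e : C) : e ^+ 2 = 1 -> J *m (e *: (J *m x) + x) = e *: (e *: (J *m x) + x).
Proof.
move=> e2; rewrite mulmxDr -scalemxAr mulmxA JJ mul1mx scalerDr scalerA -expr2 e2.
by rewrite scale1r addrC.
Qed.

Lemma homogeneous_maximal mu x : maximal_vector rho mu x ->
  exists v e, maximal_vector rho mu v /\ J *m v = e *: v.
Proof.
move=> xmax; have Jxmax := J_maximal xmax.
have [z0|z0] := eqVneq (1 *: (J *m x) + x) 0.
  exists x, (-1); split=> //.
  by apply/eqP; rewrite scaleN1r -addr_eq0 -[J *m x]scale1r z0.
exists (1 *: (J *m x) + x), 1; split; last by apply: homogeneous_part; rewrite ?expr1n.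
exact: maximal_lin.
Qed.

(** Each of [v], [w] is obtained by lowering from the other, so the two height drops [k], [k'] are
    natural numbers with sum 0; at drop 0, [w] is a multiple of [v]. *)
Lemma homogeneous_maximal_unique Lam v e mu w f :
  maximal_vector rho Lam v -> J *m v = e *: v ->
  maximal_vector rho mu w -> J *m w = f *: w -> exists c, w = c *: v.
Proof.
move=> vmax Jv wmax Jw.
have [k Dk k0] := lowered_eigenvector vmax (homogeneous_lowered vmax Jv w) wmax.1.1
  (height_weight wmax.1.2).
have [k' Dk' _] := lowered_eigenvector wmax (homogeneous_lowered wmax Jw v) vmax.1.1
  (height_weight vmax.1.2).
apply: k0; move/eqP: Dk; rewrite Dk' -addrA -[X in X == _]addr0 (inj_eq (addrI _)).
by rewrite -opprD eq_sym oppr_eq0 -natrD pnatr_eq0 addn_eq0 => /andP[_ /eqP].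
Qed.

(** The even and odd parts of [w] are zero or maximal, so the homogeneous case applies to each of
    them. *)
Lemma maximal_unique Lam v e mu w :
  maximal_vector rho Lam v -> J *m v = e *: v -> maximal_vector rho mu w ->
  exists c, w = c *: v.
Proof.
move=> vmax Jv wmax; have Jwmax := J_maximal wmax.
have part f : f ^+ 2 = 1 -> exists c, f *: (J *m w) + w = c *: v.
  move=> f2; have [->|z0] := eqVneq (f *: (J *m w) + w) 0.
    by exists 0; rewrite scale0r.
  apply: (homogeneous_maximal_unique vmax Jv (f := f) (mu := mu)).
    exact: maximal_lin.
  exact: homogeneous_part.
have [c1 D1] := part 1 (expr1n _ _).
have [c2 D2] : exists c, -1 *: (J *m w) + w = c *: v by apply: part; rewrite sqrrN expr1n.
exists ((c1 + c2) / 2); rewrite mulrC -scalerA scalerDl -D1 -D2 scale1r scaleN1r.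
rewrite addrACA subrr add0r -mulr2n -scaler_nat scalerA mulVf ?scale1r //.
by rewrite pnatr_eq0.
Qed.

End Representations.

(** * Kronecker products and sign bookkeeping *)

Section TensorAlgebra.
Variables (R : comPzRingType) (m n p q : nat).
Implicit Types (A : 'M[R]_(m, n)) (B : 'M[R]_(p, q)).

Lemma tensmxDl A A' B : tensmx (A + A') B = tensmx A B + tensmx A' B.
Proof. by apply/matrixP=> i j; rewrite !mxE mulrDl. Qed.

Lemma tensmxDr A B B' : tensmx A (B + B') = tensmx A B + tensmx A B'.
Proof. by apply/matrixP=> i j; rewrite !mxE mulrDr. Qed.

Lemma tensmxZl a A B : tensmx (a *: A) B = a *: tensmx A B.
Proof. by apply/matrixP=> i j; rewrite !mxE mulrA. Qed.

Lemma tensmxZr a A B : tensmx A (a *: B) = a *: tensmx A B.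
Proof. by apply/matrixP=> i j; rewrite !mxE mulrCA. Qed.

End TensorAlgebra.

Lemma tensmx11 (R : comPzRingType) (m n : nat) :
  tensmx (1%:M : 'M[R]_m) (1%:M : 'M_n) = 1%:M.
Proof.
apply/matrixP=> i j; case: (mxtens_indexP i) => i1 i2; case: (mxtens_indexP j) => j1 j2.
rewrite tensmxE !mxE (inj_eq (can_inj (@mxtens_indexK m n))) xpair_eqE.
by case: eqP; case: eqP; rewrite ?mul0r ?mulr0 ?mul1r.
Qed.

(** The shape of a graded bracket on a tensor product: [x] and [z] are the mixed terms, [e] is the
    sign of the bracket. *)
Lemma super_cancel (R : comPzRingType) (M : lmodType R) (e : R) (a a' b b' x z : M) :
  e * e = 1 ->
  a + x + (e *: z + b) - e *: (a' + z + (e *: x + b'))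
  = (a - e *: a') + (b - e *: b').
Proof.
move=> ee; rewrite !scalerDr scalerA ee scale1r.
rewrite [e *: z + b]addrC addrACA [x + e *: b']addrC [e *: a' + _ + _]addrACA.
by rewrite [e *: z + x]addrC opprD [LHS]addrACA subrr addr0 opprD addrACA.
Qed.

(** * The dual of the vector module *)

Section DualVector.
Variables (C : numClosedFieldType) (m n : nat).
Implicit Types p q r s t : 'I_(m + n).
Local Notation V := (@Vdual_rho C m n).
Local Notation VJ := (Vdual_J C m n).

Lemma Vdual_rhoE p q :
  V p q = (- (-1) ^+ (epar p q && par p)) *: delta_mx q p.
Proof.
apply/matrixP=> t s; rewrite !mxE eq_sym [(t == q) && _]andbC [t == q]eq_sym.
by case: eqVneq => [->|] //=; rewrite !mulr0.
Qed.

Lemma Vdual_bracket : graded_bracket V.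
Proof.
move=> p q r s; rewrite !Vdual_rhoE -!scalemxAl -!scalemxAr !scalerA !mul_delta_mx_cond.
rewrite /epar [r == q]eq_sym.
case: (eqVneq q r) => [->|_]; case: (eqVneq p s) => [->|_];
  rewrite ?(mulr1n, mulr0n, scaler0, mul0r, mulr0, scale0r, mulr1, mul1r, sub0r, subr0) //.
- rewrite [RHS]addrC -!scaleNr; congr (_ *: _ + _ *: _).
  + by case: (par r); case: (par s); rewrite /= ?expr0 ?expr1; ring.
  + by case: (par r); case: (par s); rewrite /= ?expr0 ?expr1; ring.
- rewrite -scaleNr; congr (_ *: _).
  by case: (par r); case: (par s); case: (par p); rewrite /= ?expr0 ?expr1; ring.
- rewrite -scaleNr; congr (_ *: _).
  by case: (par r); case: (par s); case: (par q); rewrite /= ?expr0 ?expr1; ring.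
Qed.

Lemma Vdual_JE : VJ = diag_mx (\row_s (-1) ^+ par s).
Proof.
apply/matrixP=> t s; rewrite !mxE; case: eqVneq => [->|]; rewrite ?mul1r ?mulr1n //.
by rewrite mul0r mulr0n.
Qed.

Lemma Vdual_JJ : VJ *m VJ = 1%:M.
Proof.
apply/matrixP=> t s; rewrite {1}Vdual_JE mul_diag_mx !mxE.
by case: eqVneq => [->|]; rewrite ?mul0r ?mulr0 // mul1r -expr2 sqrr_sign.
Qed.

(** The sign operator on $V^*$ produced when an operator of parity [e] passes the left tensor
    factor. *)
Definition Koszul (e : bool) : 'M[C]_(m + n) := if e then VJ else 1%:M.

Lemma KoszulM e f : Koszul e *m Koszul f = Koszul (e (+) f).
Proof. by case: e; case: f; rewrite /= ?mulmx1 ?mul1mx ?Vdual_JJ. Qed.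

Lemma Koszul_comm e p q :
  Koszul e *m V p q = (-1) ^+ (e && epar p q) *: (V p q *m Koszul e).
Proof.
case: e; rewrite /= ?expr0 ?scale1r ?mulmx1 ?mul1mx // Vdual_rhoE Vdual_JE.
rewrite -scalemxAr -scalemxAl; apply/matrixP=> t s.
rewrite mul_diag_mx mul_mx_diag !mxE.
case: (eqVneq t q) => [->|_]; last by rewrite !(mul0r, mulr0).
case: (eqVneq s p) => [->|_]; last by rewrite !(mul0r, mulr0).
by rewrite /epar; case: (par p); case: (par q); rewrite /= ?expr0 ?expr1; ring.
Qed.

End DualVector.

(** * The module structure on $V^*\otimes V(\Lambda)$ *)

Section TensorRepresentation.
Variables (C : numClosedFieldType) (m n d : nat) (J : 'M[C]_d).
Variable rho : 'I_(m + n) -> 'I_(m + n) -> 'M[C]_d.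
Local Notation V := (@Vdual_rho C m n).
Local Notation T := (tens_rho rho).

Hypothesis rep : is_rep J rho.

Lemma tens_rhoE p q : T p q = tensmx (V p q) 1%:M + tensmx (Koszul C m n (epar p q)) (rho p q).
Proof. by []. Qed.

Lemma tens_bracket : graded_bracket T.
Proof.
have [_ [_ brk]] := rep.
move=> p q r s; rewrite !tens_rhoE.
have expand a b c e : (tensmx (V a b) 1%:M + tensmx (Koszul C m n (epar a b)) (rho a b)) *m
   (tensmx (V c e) 1%:M + tensmx (Koszul C m n (epar c e)) (rho c e)) =
   tensmx (V a b *m V c e) 1%:M + tensmx (V a b *m Koszul C m n (epar c e)) (rho c e)
   + ((-1) ^+ (epar a b && epar c e) *: tensmx (V c e *m Koszul C m n (epar a b)) (rho a b)
   + tensmx (Koszul C m n (epar a b (+) epar c e)) (rho a b *m rho c e)).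
  rewrite mulmxDl !mulmxDr !tensmx_mul Koszul_comm KoszulM tensmxZl !mulmx1 !mul1mx.
  by [].
rewrite !expand; set sg := (-1) ^+ (epar p q && epar r s).
rewrite [epar r s && _]andbC -/sg [epar r s (+) _]addbC.
set X := tensmx (_ *m Koszul _ _ _ _) (rho r s); set Z := tensmx (_ *m Koszul _ _ _ _) (rho p q).
rewrite super_cancel -?expr2 ?sqrr_sign // -!scaleNr -tensmxZl -tensmxZr -tensmxDl -tensmxDr.
rewrite !scaleNr brk Vdual_bracket -/sg.
rewrite -!scaleNr !(tensmxDl, tensmxDr, scalerDr, scalerA, tensmxZl, tensmxZr).
(* What remains is that the parity [epar p q (+) epar r s] equals [epar p s] when [q = r] and
   [epar r q] when [p = s]. *)
rewrite addrACA; congr (_ + _); congr (_ + _).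
- by case: eqVneq => [->|]; rewrite ?scale0r //; congr (_ *: tensmx _ _); congr Koszul;
    rewrite /epar; case: (par p); case: (par r); case: (par s).
- by case: eqVneq => [->|]; rewrite ?mulr0 ?oppr0 ?scale0r //; congr (_ *: tensmx _ _); congr Koszul;
    rewrite /epar; case: (par q); case: (par r); case: (par s).
Qed.

Lemma tens_JJ : tens_J m n J *m tens_J m n J = 1%:M.
Proof. by have [JJ _] := rep; rewrite tensmx_mul JJ Vdual_JJ tensmx11. Qed.

Lemma tens_Jrho p q :
  tens_J m n J *m T p q *m tens_J m n J = (-1) ^+ epar p q *: T p q.
Proof.
have [JJ [Jrho _]] := rep.
rewrite tens_rhoE mulmxDr mulmxDl !tensmx_mul mulmx1 JJ Jrho -[Vdual_J C m n]/(Koszul C m n true).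
rewrite Koszul_comm !KoszulM -scalemxAl -mulmxA KoszulM addbb addbT negbK.
by rewrite mulmx1 tensmxZl tensmxZr scalerDr.
Qed.

(** The vector $\langle s|\otimes w$; [component] extracts the coefficient of $\langle s|$. *)
Definition tens_vec (s : 'I_(m + n)) (w : 'cV[C]_d) : 'cV[C]_((m + n) * d) :=
  \col_k (((mxtens_unindex k).1 == s)%:R * w (mxtens_unindex k).2 0).

Definition component (s : 'I_(m + n)) (x : 'cV[C]_((m + n) * d)) : 'cV[C]_d :=
  \col_i x (mxtens_index (s, i)) 0.

Lemma component_inj x y : (forall s, component s x = component s y) -> x = y.
Proof.
move=> xy; apply/colP=> k; case: (mxtens_indexP k) => s i.
by have /colP/(_ i) := xy s; rewrite !mxE.
Qed.

Lemma componentD s x y : component s (x + y) = component s x + component s y.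
Proof. by apply/colP=> i; rewrite !mxE. Qed.

Lemma componentZ s c x : component s (c *: x) = c *: component s x.
Proof. by apply/colP=> i; rewrite !mxE. Qed.

Lemma component0 s : component s 0 = 0.
Proof. by apply/colP=> i; rewrite !mxE. Qed.

Lemma component_tens_vec s t w : component s (tens_vec t w) = (s == t)%:R *: w.
Proof. by apply/colP=> i; rewrite !mxE !mxtens_indexK. Qed.

Lemma component_tensmx s A B x :
  component s (tensmx A B *m x) = \sum_t A s t *: (B *m component t x).
Proof.
apply/colP=> i; rewrite mxE summxE mxE.
under [RHS]eq_bigr => t _ do rewrite !mxE mulr_sumr.
rewrite pair_big (reindex (@mxtens_index (m + n) d)) /=.
  by apply: eq_bigr => -[t j] _; rewrite tensmxE !mxE mulrA.
by exists (@mxtens_unindex _ _) => k _; rewrite ?mxtens_indexK ?mxtens_unindexK.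
Qed.

Lemma component_act t p q x : component t (T p q *m x) =
  (- (-1) ^+ (epar p q && par p) * (q == t)%:R) *: component p x
  + (-1) ^+ (epar p q && par t) *: (rho p q *m component t x).
Proof.
rewrite tens_rhoE mulmxDl componentD !component_tensmx; congr (_ + _).
  rewrite (bigD1 p) //= big1 ?addr0 ?mul1mx ?Vdual_rhoE => [|s /negPf sp].
    by rewrite !mxE eqxx andbT [t == q]eq_sym.
  by rewrite !mxE sp andbF mulr0 scale0r.
rewrite (bigD1 t) //= big1 ?addr0 => [|s /negPf st].
  by case: epar; rewrite /= !mxE eqxx ?mul1r ?expr0.
by case: epar; rewrite /= !mxE eq_sym st ?mul0r scale0r.
Qed.

Lemma act_tens_vec p q s w : T p q *m tens_vec s w =
  (- (-1) ^+ (epar p q && par p) * (p == s)%:R) *: tens_vec q w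
  + (-1) ^+ (epar p q && par s) *: tens_vec s (rho p q *m w).
Proof.
apply: component_inj => t.
rewrite component_act componentD !componentZ !component_tens_vec -scalemxAr !scalerA.
rewrite -!mulrA [(q == t)%:R * _]mulrC [q == t]eq_sym; congr (_ + _ *: _).
by case: (eqVneq t s) => [->//|_]; rewrite !mulr0.
Qed.

Lemma tens_vecD s x y : tens_vec s (x + y) = tens_vec s x + tens_vec s y.
Proof. by apply/colP=> k; rewrite !mxE mulrDr. Qed.

Lemma tens_vecZ s c x : tens_vec s (c *: x) = c *: tens_vec s x.
Proof. by apply/colP=> k; rewrite !mxE mulrCA. Qed.

Lemma sum_tens_vec x : x = \sum_s tens_vec s (component s x).
Proof.
apply/colP=> k; case: (mxtens_indexP k) => s i; rewrite summxE (bigD1 s) //= big1.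
  by rewrite !mxE mxtens_indexK /= eqxx mul1r addr0.
by move=> t /negPf ts; rewrite !mxE mxtens_indexK /= eq_sym ts mul0r.
Qed.

(** * Maximal vectors of the tensor product *)

Hypothesis irr : irreducible J rho.
Variables (Lam : 'I_(m + n) -> C) (v : 'cV[C]_d) (e : C).
Hypotheses (vmax : maximal_vector rho Lam v) (Jv : J *m v = e *: v).

Let brk : graded_bracket rho := rep.2.2.
Local Notation shift r := (fun p => Lam p - eps C r p).

(** For $p<q$, the action on $V^*$ contributes to component [r] of $E_{pq}x$ only when [q = r], and
    then through component [p], which vanishes by minimality of [r]. So the leading component is
    itself maximal. *)
Lemma tens_maximal_leading mu x : maximal_vector T mu x ->
  exists r c, [/\ c != 0, component r x = c *: v,
    forall s : 'I_(m + n), (s < r)%N -> component s x = 0 & forall p, mu p = Lam p - eps C r p].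
Proof.
move=> [[x0 xmu] xmax].
have [r0 r0P] : exists r, component r x != 0.
  apply: NNPP => none; case/negP: x0; apply/eqP/component_inj => s.
  rewrite component0; apply/eqP/negP => /negP xs; apply: none.
  by exists s.
pose r := [arg min_(i < r0 | component i x != 0%R) (i : nat)]%N.
have [xr low] : component r x != 0 /\ forall s : 'I_(m + n), (s < r)%N -> component s x = 0.
  rewrite /r; case: arg_minnP => // i xi imin; split=> // s lt_si.
  by apply/eqP; apply: contraTT lt_si => xs; rewrite -leqNgt imin.
have wt p : rho p p *m component r x = (mu p + eps C r p) *: component r x.
  have := congr1 (component r) (xmu p); rewrite component_act componentZ eparpp /=.
  rewrite expr0 scale1r mulN1r scaleNr => /eqP; rewrite addrC subr_eq => /eqP->.
  by rewrite scalerDl /eps; case: eqVneq => [->|]; rewrite ?scale0r.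
have rmax : maximal_vector rho (fun p => mu p + eps C r p) (component r x).
  split=> // p q lt_pq; have := congr1 (component r) (xmax p q lt_pq).
  rewrite component0 component_act.
  case: (eqVneq q r) => [qr|_]; first rewrite low ?scaler0 ?add0r -?qr //.
    by move/eqP; rewrite scaler_eq0 signr_eq0 => /eqP.
  by rewrite mulr0 scale0r add0r => /eqP; rewrite scaler_eq0 signr_eq0 => /eqP.
have [c Dc] := maximal_unique brk rep.1 rep.2.1 irr vmax Jv rmax.
have c0 : c != 0 by apply: contra xr => /eqP c0; rewrite Dc c0 scale0r.
exists r, c; split=> // p; have := wt p; rewrite Dc -scalemxAr vmax.1.2 scalerA mulrC.
rewrite -scalerA => /(scalerI c0)/eqP.
rewrite -subr_eq0 -scalerBl scaler_eq0 (negPf vmax.1.1) orbF.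
by rewrite subr_eq0 => /eqP->; rewrite addrK.
Qed.

Lemma shift_inj (r s : 'I_(m + n)) :
  (forall p, Lam p - eps C r p = Lam p - eps C s p) -> r = s.
Proof.
move/(_ r)/addrI/oppr_inj; rewrite /eps eqxx.
by case: (eqVneq r s) => // _ /eqP; rewrite oner_eq0.
Qed.

(** The weight determines the leading index. The combination of [x] and [y] cancelling that
    component, if nonzero, would be maximal of the same weight and hence have a nonzero component
    there. *)
Lemma tens_maximal_unique mu x y : maximal_vector T mu x -> maximal_vector T mu y ->
  exists c, y = c *: x.
Proof.
move=> xmax ymax; have [r [a [a0 xr _ mur]]] := tens_maximal_leading xmax.
have [s [b [_ ys _ mus]]] := tens_maximal_leading ymax.
have rs : r = s by apply: shift_inj => p; rewrite -mur.
subst s; exists (b / a); apply/eqP; rewrite -subr_eq0; apply/negPn/negP => z0.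
have zmax : maximal_vector T mu (- (b / a) *: x + y).
  by apply: maximal_lin => //; rewrite addrC scaleNr.
have [t [c [c0 zt _ mut]]] := tens_maximal_leading zmax.
have rt : r = t by apply: shift_inj => p; rewrite -mur.
subst t; move: zt; rewrite componentD componentZ xr ys scalerA mulNr divfK // scaleNr.
rewrite addNr => /esym/eqP; rewrite scaler_eq0 (negPf c0) /=.
by move: vmax.1.1 => /negPf->.
Qed.

(** * The filtration and the action of the Casimir element on it *)

Definition filtration (t : nat) : 'cV[C]_((m + n) * d) -> Prop :=
  generated T (fun x => exists s : 'I_(m + n), (t <= s)%N /\ x = tens_vec s v).

Lemma filtration_tens_vec t (s : 'I_(m + n)) : (t <= s)%N -> filtration t (tens_vec s v).
Proof. by move=> ts; apply: generated_in; exists s. Qed.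

(** Since [v] generates under lowering, induct on [w]: up to signs, $\langle s|\otimes E_{pq}y$ is
    $E_{pq}(\langle s|\otimes y)$ corrected by a multiple of $\langle q|\otimes y$. The induction
    hypothesis must therefore cover every index [s]. *)
Lemma filtration0 x : filtration 0 x.
Proof.
have [F0 FD FZ] : subspace (filtration 0) by apply: generated_subspace.
rewrite [x]sum_tens_vec; apply: subspace_sum => // s; move: (component s x) => w.
have := homogeneous_lowered brk rep.1 rep.2.1 irr vmax Jv w => lw.
elim: lw s => {w} [||y z _ Fy _ Fz|c y _ Fy|p q y _ _ Fy] s.
- exact: filtration_tens_vec.
- by rewrite -(scale0r 0) tens_vecZ scale0r.
- by rewrite tens_vecD; apply: FD.
- by rewrite tens_vecZ; apply: FZ.
have /eqP := act_tens_vec p q s y; rewrite addrC -subr_eq => /eqP Dz.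
rewrite -[tens_vec _ _](signrZK (epar p q && par s)) -Dz.
apply/FZ; apply: subspaceB; [exact: generated_subspace| exact/generated_act/Fy|].
exact: FZ.
Qed.

Lemma filtration_cartan r p :
  T p p *m tens_vec r v = (Lam p - eps C r p) *: tens_vec r v.
Proof.
rewrite act_tens_vec eparpp /= expr0 scale1r vmax.1.2 tens_vecZ scalerBl addrC mulN1r.
by rewrite scaleNr /eps; case: eqVneq => [->|]; rewrite ?scale0r.
Qed.

(** A raising operator kills [v] and can move $\langle r|$ only to some $\langle q|$ with $q>r$;
    this is why the filtration keeps the indices [s >= t]. *)
Lemma filtration_raise (r p q : 'I_(m + n)) : (p < q)%N ->
  filtration r.+1 (T p q *m tens_vec r v).
Proof.
move=> lt_pq; rewrite act_tens_vec vmax.2 // -(scale0r 0) tens_vecZ scale0r scaler0 addr0.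
have [F0 _ FZ] : subspace (filtration r.+1) by apply: generated_subspace.
case: (eqVneq p r) => [pr|_]; last by rewrite mulr0 scale0r.
by apply/FZ/filtration_tens_vec; rewrite -pr.
Qed.

Let brkT : graded_bracket T := @tens_bracket.

Lemma filtration_casimir (r : 'I_(m + n)) : filtration r.+1
  (casimir T *m tens_vec r v - chi (shift r) *: tens_vec r v).
Proof.
apply: (casimir_eigen_mod brkT) (filtration_cartan r) _.
- exact: generated_subspace.
- exact: generated_stable.
- exact: filtration_raise.
Qed.

Lemma casimir_stable (Y : 'cV[C]_((m + n) * d) -> Prop) x :
  subspace Y -> stable T Y -> Y x -> Y (casimir T *m x).
Proof.
move=> sY stY Yx; have [_ _ YZ] := sY.
rewrite mulmx_suml; apply: subspace_sum => // p.
rewrite mulmx_suml; apply: subspace_sum => // q.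
by rewrite -scalemxAl -mulmxA; apply/YZ/stY/stY.
Qed.

(** * Separation by Casimir eigenvalues *)

Hypothesis chi_inj : forall r s : 'I_(m + n), chi (shift r) = chi (shift s) -> r = s.

(* The witness is the product of the [casimir - chi (shift s)] over [s >= t]. *)
Lemma filtration_annihilator t : (t <= m + n)%N -> exists M,
  [/\ forall p q, M *m T p q = T p q *m M,
      forall x, filtration t x -> M *m x = 0,
      forall Y x, subspace Y -> stable T Y -> Y x -> Y (M *m x)
    & forall r : 'I_(m + n), (r < t)%N -> exists2 c, c != 0 &
      forall Y x, subspace Y -> stable T Y ->
        Y (casimir T *m x - chi (shift r) *: x) -> Y (M *m x - c *: x)].
Proof.
move=> le_t; have [j] : exists j, (t + j = m + n)%N by exists (m + n - t)%N; rewrite subnKC.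
elim: j t {le_t} => [|j IH] t Dt.
  (* Downward induction starts at [t = m + n], where there are no generators and the filtration step
     is zero. *)
  exists 1%:M; split=> [p q|x|Y x _ _|r _]; rewrite ?mulmx1 ?mul1mx //.
    apply: (@generated_min _ _ _ _ _ _ (fun y => y = 0)) => [|p q y ->|y [s [le_ts _]]]; rewrite ?mulmx0 //.
      by split=> // [? ? -> ->|c ? ->]; rewrite ?addr0 ?scaler0.
    by move: le_ts; rewrite leqNgt -[t]addn0 Dt ltn_ord.
  by exists 1 => [|Y x [Y0 _ _] _ _]; rewrite ?oner_eq0 // mul1mx scale1r subrr.
have lt_t : (t < m + n)%N by rewrite -Dt -addSnnS leq_addr.
have [M [McT M0 MY Meig]] := IH t.+1 (etrans (addSnnS t j) Dt).
pose a := chi (shift (Ordinal lt_t)).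
have actE x : (M *m (casimir T - a%:M)) *m x = M *m (casimir T *m x - a *: x).
  by rewrite -mulmxA mulmxBl mul_scalar_mx.
exists (M *m (casimir T - a%:M)); split=> [p q|x|Y x sY stY Yx|r lt_rt].
- rewrite -mulmxA mulmxBl -(casimir_comm brkT) mul_scalar_mx -mul_mx_scalar -mulmxBr.
  by rewrite !mulmxA McT.
- have [F0 FD FZ] : subspace (filtration t.+1) by apply: generated_subspace.
  (* The kernel [P] is a submodule, so generators suffice. The new factor sends $\langle t|\otimes
     v$ into the next step, and the generators with [s > t] already lie there; [M] kills that
     step. *)
  pose P (x : 'cV[C]_((m + n) * d)) := M *m (casimir T *m x - a *: x) = 0.
  rewrite actE -[_ = 0]/(P x) => Fx; apply: (@generated_min _ _ _ _ _ _ P _ _ _ _ Fx).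
  + split; rewrite /P.
    * by rewrite mulmx0 scaler0 subr0 mulmx0.
    * by move=> y z Py Pz; rewrite [casimir T *m _]mulmxDr scalerDr opprD addrACA mulmxDr Py Pz addr0.
    * move=> c y Py; rewrite -[casimir T *m _]scalemxAr scalerA [a * c]mulrC -scalerA -scalerBr.
      by rewrite -scalemxAr Py scaler0.
  + move=> p q y Py; rewrite /P mulmxA -(casimir_comm brkT) -mulmxA scalemxAr -mulmxBr.
    by rewrite mulmxA McT -mulmxA Py mulmx0.
  + move=> _ [s [le_ts ->]]; apply: M0; have [Ds|ts] := eqVneq (t : nat) s.
      have -> : a = chi (shift s).
        by rewrite /a; have -> : Ordinal lt_t = s by apply: val_inj.
      by rewrite Ds; apply: filtration_casimir.
    have Fs : filtration t.+1 (tens_vec s v).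
      by apply: filtration_tens_vec; rewrite ltn_neqAle ts.
    apply: subspaceB; [exact: generated_subspace | | exact: FZ].
    by apply: casimir_stable; [exact: generated_subspace | exact: generated_stable |].
- have [_ _ YZ] := sY; rewrite actE; apply: MY => //; apply: subspaceB => //.
    exact: casimir_stable.
  exact: YZ.
have [c c0 cP] := Meig r (ltnW lt_rt).
(* Modulo [Y] the new factor acts on [x] by [chi (shift r) - a], nonzero by [chi_inj] because
   [r < t]. *)
exists (c * (chi (shift r) - a)) => [|Y x sY stY Yx].
  rewrite mulf_neq0 // subr_eq0; apply/eqP => /chi_inj Dr.
  by rewrite Dr ltnn in lt_rt.
have [_ YD YZ] := sY.
rewrite actE; set z := _ - chi (shift r) *: x in Yx.
have -> : casimir T *m x - a *: x = z + (chi (shift r) - a) *: x.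
  by rewrite scalerBl addrA subrK.
rewrite mulmxDr -addrA; apply: YD; first exact: MY.
by rewrite [c * _]mulrC -scalerA -scalemxAr -scalerBr; apply/YZ; apply: cP.
Qed.

(** The annihilator [M] of [filtration r.+1] commutes with the action and kills all raised images of
    $\langle r|\otimes v$, so it makes this vector maximal. The result is a nonzero multiple of
    $\langle r|\otimes v$ modulo [Y], hence outside [Y]. *)
Lemma maximal_outside (Y : 'cV[C]_((m + n) * d) -> Prop) x :
  subspace Y -> stable T Y -> ~ Y x ->
  exists r u, maximal_vector T (shift r) u /\ ~ Y u.
Proof.
move=> sY stY nYx; have [Y0 YD YZ] := sY.
(* [r] is the largest index with $\langle r|\otimes v$ outside [Y]; if there were none, [Y] would
   contain [filtration 0], which is everything. *)
have [r [nYr Yr]] : exists r : 'I_(m + n), ~ Y (tens_vec r v) /\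
    forall y, filtration r.+1 y -> Y y.
  apply: NNPP => none; apply: nYx.
  have step j : forall t, (t + j = m + n)%N -> forall y, filtration t y -> Y y.
    elim: j => [|j IH] t Dt; apply: generated_min => // _ [s [le_ts ->]].
      by move: le_ts; rewrite leqNgt -[t]addn0 Dt ltn_ord.
    have IH' := IH t.+1 (etrans (addSnnS t j) Dt).
    have [Ds|ts] := eqVneq (t : nat) s; last first.
      by apply/IH'/filtration_tens_vec; rewrite ltn_neqAle ts.
    by apply: NNPP => nYs; apply: none; exists s; rewrite -Ds.
  exact: step (filtration0 x).
have [M [McT M0 MY /(_ r (ltnSn r))[c c0 cP]]] := filtration_annihilator (ltn_ord r).
have nYu : ~ Y (M *m tens_vec r v).
  move=> Yu; apply: nYr; rewrite -[tens_vec r v]scale1r -(mulVf c0) -scalerA; apply/YZ.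
  rewrite -(subKr (M *m tens_vec r v) (c *: _)); apply: subspaceB => //.
  by apply: cP => //; apply: Yr; apply: filtration_casimir.
exists r, (M *m tens_vec r v); split=> //; split; first split.
- by apply/eqP => u0; rewrite u0 in nYu.
- by move=> p; rewrite mulmxA -McT -mulmxA filtration_cartan -scalemxAr.
by move=> p q lt_pq; rewrite mulmxA -McT -mulmxA M0 //; apply: filtration_raise.
Qed.

Lemma maximal_generated_disjoint (Y : 'cV[C]_((m + n) * d) -> Prop) r u :
  subspace Y -> stable T Y -> maximal_vector T (shift r) u -> ~ Y u ->
  forall y, generated T (eq u) y -> Y y -> y = 0.
Proof.
move=> sY stY umax nYu y Ly Yy; apply: NNPP => /eqP y0; apply: nYu.
pose L := generated T (eq u).
have sLY : subspace (fun z => L z /\ Y z).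
  have [L0 LD LZ] : subspace L by apply: generated_subspace.
  have [Y0 YD YZ] := sY.
  by split=> [//|z w [Lz Yz] [Lw Yw]|c z [Lz Yz]]; split; auto.
have stLY : stable T (fun z => L z /\ Y z).
  by move=> p q z [Lz Yz]; split; [apply: generated_act | apply: stY].
have [mu [z [[Lz Yz] zmax]]] := maximal_vector_exists brkT sLY stLY (conj Ly Yy) y0.
(* By centrality the eigenvalue at [u] spreads to the whole module generated by [u], in particular
   to [z]. *)
have casL w : L w -> casimir T *m w = chi (shift r) *: w.
  apply: (@generated_min _ _ _ _ _ _ (fun w => casimir T *m w = chi (shift r) *: w)).
  - split; first by rewrite mulmx0 scaler0.
      by move=> ? ? E1 E2; rewrite mulmxDr E1 E2 scalerDr.
    by move=> c ? E1; rewrite -scalemxAr E1 !scalerA mulrC.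
  - by move=> p q w' E1; rewrite mulmxA -(casimir_comm brkT) -mulmxA E1 scalemxAr.
  - by move=> _ <-; apply: casimir_maximal.
have [s [_ [_ _ _ mus]]] := tens_maximal_leading zmax.
have rs : r = s.
  apply: chi_inj; have /eqP := casL z Lz.
  rewrite (casimir_maximal brkT zmax) -subr_eq0 -scalerBl scaler_eq0.
  rewrite (negPf zmax.1.1) orbF subr_eq0 => /eqP <-.
  by apply: eq_bigr => p _; rewrite mus.
have zmax' : maximal_vector T (shift r) z.
  by split; [split=> [|p]; [exact: zmax.1.1 | rewrite zmax.1.2 mus rs] | exact: zmax.2].
have [c ->] := tens_maximal_unique zmax' umax.
by have [_ _ YZ] := sY; apply: YZ.
Qed.

(** * Construction of the complement *)

Local Notation TJ := (tens_J m n J).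

(** Induction on a bound [k] for the codimension of [U + W]: adding to [W] the module generated by a
    maximal vector outside [U + W] lowers it. *)
Lemma complement_extend k (U W : 'M[C]_((m + n) * d)) :
  submod TJ T U -> submod TJ T W -> \rank (U :&: W)%MS = 0%N ->
  ((m + n) * d - \rank (U + W)%MS <= k)%N ->
  exists W', submod TJ T W' /\ \rank (U :&: W')%MS = 0%N /\ row_full (U + W')%MS.
Proof.
elim: k W => [|k IH] W sU sW UW0 le_k.
  exists W; do 2 split=> //; rewrite -col_leq_rank -subn_eq0 -leqn0.
  exact: le_k.
have [full|nfull] := boolP (row_full (U + W)%MS); first by exists W.
pose Y (x : 'cV[C]_((m + n) * d)) : Prop := (x^T <= U + W)%MS.
have sY : subspace Y by apply: subspace_rows.
have [stU _] := submod_subspace sU; have [stW _] := submod_subspace sW.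
have stY : stable T Y.
  move=> p q x; rewrite /Y trmx_mul => xUW; apply: submx_trans (submxMr _ xUW) _.
  by rewrite addsmxMr addsmxS ?sU.2 ?sW.2.
have [x nYx] : exists x, ~ Y x.
  apply: not_all_ex_not => allY; case/negP: nfull; rewrite -sub1mx.
  by apply: rows_subP => x _; apply: allY.
have [r [u [umax nYu]]] := maximal_outside sY stY nYx.
pose L := generated T (eq u).
(* [J] preserves maximal vectors and their weights, so uniqueness makes [u] homogeneous and the
   module it generates graded. *)
have [c Du] : exists c, TJ *m u = c *: u.
  exact: (tens_maximal_unique umax (J_maximal tens_JJ tens_Jrho umax)).
have LJ : forall x, L x -> L (TJ *m x).
  apply: (generated_J tens_JJ tens_Jrho) => _ <-.
  by rewrite Du; apply/generatedZ/generated_in.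
have [WL sWL WLP] := submod_pred (generated_subspace _ _) (@generated_stable _ _ _ _ _ _) LJ.
have L0 := maximal_generated_disjoint sY stY umax nYu.
apply: (IH (W + WL)%MS) => //.
- by split=> [|p q]; rewrite addsmxMr addsmxS ?sW.1 ?sWL.1 ?sW.2 ?sWL.2.
- apply/eqP; rewrite mxrank_eq0 -submx0; apply: rows_subP => z.
  (* The part of [z] in [WL] is a difference of elements of [U] and [W], so it lies in [Y] as well
     and vanishes; then [z] lies in both [U] and [W]. *)
  rewrite sub_capmx => /andP[zU /sub_addsmxP[[a b] /= Dz]].
  have bL : (b *m WL)^T = 0.
    apply: L0; first by apply/WLP; rewrite trmxK submxMl.
    rewrite /Y trmxK; have -> : b *m WL = z^T - a *m W by rewrite Dz addrC addKr.
    rewrite addmx_sub ?(submx_trans zU) ?addsmxSl // eqmx_opp.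
    by rewrite (submx_trans (submxMl _ _)) ?addsmxSr.
  have {}bL : b *m WL = 0 by rewrite -[b *m WL]trmxK bL trmx0.
  have : (z^T <= U :&: W)%MS by rewrite sub_capmx zU Dz bL addr0 submxMl.
  by move/eqP: UW0; rewrite mxrank_eq0 => /eqP->.
rewrite -ltnS; apply: leq_trans le_k; apply: ltn_sub2l.
  by rewrite ltn_neqAle rank_leq_col andbT.
apply: rank_ltmx; rewrite /ltmx addsmxA addsmxSl /=.
apply/negP => sub; apply: nYu; apply: submx_trans sub.
apply: submx_trans (addsmxSr _ _); apply/WLP.
exact: generated_in.
Qed.

End TensorRepresentation.

Theorem theorem10 (C : numClosedFieldType) (m n d : nat) (J : 'M[C]_d)
  (rho : 'I_(m + n) -> 'I_(m + n) -> 'M[C]_d) (Lam : 'I_(m + n) -> C) :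
  is_rep J rho ->
  irreducible J rho ->
  (exists v : 'cV[C]_d, maximal_vector rho Lam v) ->
  (forall r1 r2 : 'I_(m + n),
     chi (fun p => Lam p - eps C r1 p) = chi (fun p => Lam p - eps C r2 p) ->
     r1 = r2) ->
  completely_reducible (tens_J m n J) (tens_rho rho) /\
  (forall (mu : 'I_(m + n) -> C) (v : 'cV[C]_((m + n) * d)),
     maximal_vector (tens_rho rho) mu v ->
     exists r : 'I_(m + n), forall p, mu p = Lam p - eps C r p) /\
  (forall (mu : 'I_(m + n) -> C) (v w : 'cV[C]_((m + n) * d)),
     maximal_vector (tens_rho rho) mu v ->
     maximal_vector (tens_rho rho) mu w ->
     exists c : C, w = c *: v).
Proof.
move=> rep irr [v0 v0max] chi_inj.
(* The given maximal vector may mix parities, so it is first replaced by a homogeneous one of the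
   same weight. *)
have [v [e [vmax Jv]]] := homogeneous_maximal rep.1 rep.2.1 v0max.
split; [|split].
- move=> U sU; apply: (complement_extend rep irr vmax Jv chi_inj (W := 0)) sU _ _ (leqnn _).
    by split=> [|p q]; rewrite mul0mx sub0mx.
  by apply/eqP; rewrite mxrank_eq0 -submx0 capmxSr.
- by move=> mu x /(tens_maximal_leading rep irr vmax Jv)[r [c [_ _ _ mur]]]; exists r.
by move=> mu x y; apply: (tens_maximal_unique rep irr vmax Jv).
Qed.
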